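(* There exist universal constants $\bar c,\hat c>0$ such that the following holds. Let $p>0$, $L,\delta^0,\varepsilon>0$ and an integer $n\ge2$ be any numbers such that $\bar c\,\varepsilon<L\delta^0$. Let $\eta_{i,j}^k$ ($i\in[n]$, $j\ge1$, $k\ge0$) be real random variables with $\mathbb P(\eta_{i,j}^k\neq0)\le p$ for all $i,j,k$, such that the sets $\{\eta_{i,j}^0\}_{i,j},\{\eta_{i,j}^1\}_{i,j},\dots,\{\eta_{i,j}^k\}_{i,j},\dots$ are mutually independent (the variables within one set can be dependent). Then for any zero-respecting algorithm $A\in\mathcal A_{\rm zr}$ there exist a dimension $d$, a function $f:\mathbb R^d\to\mathbb R$ with $f\in\mathcal F_{\delta^0,L}$, and differentiable functions $f_1,\dots,f_n:\mathbb R^d\to\mathbb R$ with $f=\frac1n\sum_{i=1}^nf_i$, such that the points $x^k$ produced by the Sparsified Protocol (described in the context) run with $f_1,\dots,f_n$, $A$ and the variables $\eta_{i,j}^k$ ($j\le d$) satisfy $$\mathbb E\left[\|\nabla f(x^k)\|^2\right]>\varepsilon\quad\text{for all integers }0\le k\le\hat c\,\frac{L\delta^0}{p\,\varepsilon}.$$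
   Context: $\|\cdot\|$ is the Euclidean norm; $[n]=\{1,\dots,n\}$; $[v]_j$ is the $j$-th coordinate of $v$; $\mathrm{supp}(x)=\{i: x_i\ne 0\}$; an empty union is $\emptyset$. Function class: $\mathcal F_{\delta^0,L}$ is the set of differentiable $f:\mathbb R^d\to\mathbb R$ (any $d$) with $\|\nabla f(x)-\nabla f(y)\|\le L\|x-y\|$ for all $x,y$ and $f(0)-\inf_x f(x)\le\delta^0$. Sparsified Protocol: given $f_1,\dots,f_n$ on $\mathbb R^d$ and an algorithm $A=\{(B_1^k,B_{2,1}^k,\dots,B_{2,n}^k,L_1^k,\dots,L_n^k)\}_{k\ge0}$, for $k=0,1,2,\dots$: (1) the server computes $x^k=B_1^k(g_1^1,\dots,g_1^k,\dots,g_n^1,\dots,g_n^k)$; (2) the server computes $s_i^k=B_{2,i}^k(g_1^1,\dots,g_1^k,\dots,g_n^1,\dots,g_n^k)$ for $i\in[n]$; (3) the server sends to worker $i$ the sparsified vector $\bar s_i^k$ with $[\bar s_i^k]_j=[s_i^k]_j\,\eta_{i,j}^k$ for $j\in[d]$, for each $i\in[n]$; (4) worker $i$ computes $g_i^{k+1}=L_i^k(\bar s_i^0,\dots,\bar s_i^k)$, where $L_i^k$ has access to the gradient oracle of $f_i$ (may call $\nabla f_i$ arbitrarily many times subject to the support rule below), and sends $g_i^{k+1}$ to the server. Zero-respecting algorithms: $A\in\mathcal A_{\rm zr}$ means that (for each dimension $d$) $A$ is a sequence of such tuples of deterministic mappings with $B_1^k,B_{2,i}^k:(\mathbb R^d)^{nk}\to\mathbb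 R^d$ for $k\ge1$, $B_1^0,B_{2,i}^0\in\mathbb R^d$, $L_i^k:(\mathbb R^d)^{k+1}\to\mathbb R^d$, and for all $k\ge0$, $i\in[n]$: $\mathrm{supp}(x^k)\subseteq\bigcup_{j=1}^k\bigcup_{l=1}^n\mathrm{supp}(g_l^j)$, $\mathrm{supp}(s_i^k)\subseteq\bigcup_{j=1}^k\bigcup_{l=1}^n\mathrm{supp}(g_l^j)$, and there are vectors $\hat g_{i,1}^{k+1},\hat g_{i,2}^{k+1},\dots$ with $\mathrm{supp}(\hat g_{i,m}^{k+1})\subseteq\bigcup_{j=0}^k\mathrm{supp}(\bar s_i^j)\cup\bigcup_{r=1}^{m-1}\mathrm{supp}(\nabla f_i(\hat g_{i,r}^{k+1}))$ for all $m\ge1$, such that $\mathrm{supp}(g_i^{k+1})\subseteq\bigcup_{m\ge1}\mathrm{supp}(\hat g_{i,m}^{k+1})$. *)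

(* Defs.v *)
From mathcomp Require Import all_boot all_order all_algebra.
From mathcomp Require Import finmap.
From mathcomp Require Import all_classical all_reals all_analysis.

Set Implicit Arguments.
Unset Strict Implicit.
Unset Printing Implicit Defensive.

Import Order.TTheory GRing.Theory Num.Theory.
Import numFieldNormedType.Exports.

Local Open Scope classical_set_scope.
Local Open Scope ring_scope.

(* The library norm on ['rV[R]_d] is the sup norm, hence this definition.
   Differentiability does not depend on the choice of norm. *)
Definition enorm (R : realType) (d : nat) (x : 'rV[R]_d) : R :=
  Num.sqrt (\sum_(j < d) x ord0 j ^+ 2).

Definition grad (R : realType) (d : nat) (f : 'rV[R]_d -> R)
    (x : 'rV[R]_d) : 'rV[R]_d :=
  \row_(j < d) 'D_(delta_mx ord0 j) f x.

Definition supp (R : realType) (d : nat) (x : 'rV[R]_d) : set 'I_d :=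
  [set j | x ord0 j != 0].

(* The infimum is taken in the extended reals: when [f] is unbounded below the
   left-hand side of the last inequality is [+oo]. *)
Definition function_class (R : realType) (delta0 L : R) (d : nat)
    (f : 'rV[R]_d -> R) : Prop :=
  [/\ forall x, differentiable f x,
      forall x y, enorm (grad f x - grad f y) <= L * enorm (x - y) &
      ((f 0)%:E - ereal_inf [set (f x)%:E | x in [set: 'rV[R]_d]]
         <= delta0%:E)%E].

(* [B1 A d k], [B2 A d k i] and [Lw A d k i] are the maps B_1^k, B_{2,i}^k and
   L_i^k in dimension [d].  A server map receives the messages
   g_l^{j+1} ([j : 'I_k], [l : 'I_n]), so that it is a constant for [k = 0].
   A worker map receives the gradient oracle of its function, as a function
   that it may query at will, and the sparsified vectors of the rounds 0..k. *)
Record algorithm (R : realType) (n : nat) := Algorithm {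
  B1 : forall d k : nat, ('I_k -> 'I_n -> 'rV[R]_d) -> 'rV[R]_d;
  B2 : forall d k : nat, 'I_n -> ('I_k -> 'I_n -> 'rV[R]_d) -> 'rV[R]_d;
  Lw : forall d k : nat, 'I_n -> ('rV[R]_d -> 'rV[R]_d) ->
         ('I_k.+1 -> 'rV[R]_d) -> 'rV[R]_d
}.
Arguments B1 {R n} A d k g : rename.
Arguments B2 {R n} A d k i g : rename.
Arguments Lw {R n} A d k i oracle s : rename.

Section Protocol.
Variables (R : realType) (n : nat) (A : algorithm R n) (d : nat).
(* [G i] is the gradient oracle of worker [i]; [e k i j] is the multiplier
   eta_{i,j+1}^k. *)
Variables (G : 'I_n -> 'rV[R]_d -> 'rV[R]_d) (e : nat -> 'I_n -> nat -> R).

Definition sparsify (k : nat) (i : 'I_n) (s : 'rV[R]_d) : 'rV[R]_d :=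
  \row_(j < d) (s ord0 j * e k i j).

(* For [m < k], [history k m i] is the message g_i^{m+1}; the values at
   [m >= k] are irrelevant. *)
Fixpoint history (k : nat) : nat -> 'I_n -> 'rV[R]_d :=
  if k is k'.+1 then
    fun m i =>
      if m == k' then
        Lw A d k' i (G i) (fun l : 'I_k'.+1 =>
          sparsify l i (B2 A d l i (fun j : 'I_l => history k' j)))
      else history k' m i
  else fun _ _ => 0.

(* [message k i] is g_i^{k+1}. *)
Definition message (k : nat) (i : 'I_n) : 'rV[R]_d := history k.+1 k i.

Definition server_point (k : nat) : 'rV[R]_d := B1 A d k (fun j : 'I_k => message j).

Definition server_vec (k : nat) (i : 'I_n) : 'rV[R]_d :=
  B2 A d k i (fun j : 'I_k => message j).

Definition sparse_vec (k : nat) (i : 'I_n) : 'rV[R]_d :=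
  sparsify k i (server_vec k i).

Lemma history_message k m : (m < k)%N -> history k m = message m.
Proof.
elim: k => // k IHk; rewrite ltnS leq_eqVlt => /predU1P[-> //|lt_mk].
by rewrite -IHk //; apply/funext => i /=; rewrite ltn_eqF.
Qed.

Lemma messageE k i :
  message k i = Lw A d k i (G i) (fun l : 'I_k.+1 => sparse_vec l i).
Proof.
rewrite /message /= eqxx; congr (Lw _ _ _ _ _ _); apply/funext => l.
rewrite /sparse_vec /server_vec; congr (sparsify l i (B2 A d l i _)).
apply/funext => j; apply: history_message.
exact: leq_trans (ltn_ord j) (ltn_ord l).
Qed.

End Protocol.

(* The support conditions are imposed on every run of the protocol: for all
   differentiable local functions and all values of the multipliers.
   The vectors [ghat m] are indexed from 0. *)
Definition zero_respecting (R : realType) (n : nat) (A : algorithm R n) : Prop :=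
  forall (d : nat) (fs : 'I_n -> 'rV[R]_d -> R) (e : nat -> 'I_n -> nat -> R),
    (forall i x, differentiable (fs i) x) ->
    let G := fun i => grad (fs i) in
    forall (k : nat) (i : 'I_n),
      [/\ supp (server_point A G e k) `<=`
            \bigcup_(j < k) \bigcup_(l : 'I_n) supp (message A G e j l),
          supp (server_vec A G e k i) `<=`
            \bigcup_(j < k) \bigcup_(l : 'I_n) supp (message A G e j l) &
          exists ghat : nat -> 'rV[R]_d,
            (forall m, supp (ghat m) `<=`
               (\bigcup_(j < k.+1) supp (sparse_vec A G e j i)) `|`
               (\bigcup_(r < m) supp (grad (fs i) (ghat r)))) /\
            supp (message A G e k i) `<=` \bigcup_m supp (ghat m)].

Definition sigma_generated (dd : measure_display) (T : measurableType dd)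
    (R : realType) (I : Type) (X : I -> T -> R) : set (set T) :=
  <<s \bigcup_(i : I) [set X i @^-1` B | B in measurable] >>.

Definition mutually_independent (dd : measure_display) (T : measurableType dd)
    (R : realType) (P : probability T R) (S : nat -> set (set T)) : Prop :=
  forall (K : {fset nat}) (E : nat -> set T),
    (forall k, k \in K -> S k (E k)) ->
    P (\bigcap_(k in [set` K]) E k) = (\prod_(k <- K) P (E k))%E.

(* Main.v *)
From HB Require Import structures.
Require Import Defs.
From mathcomp Require Import all_boot all_order all_algebra ring lra zify.
From mathcomp Require Import finmap.
From mathcomp Require Import all_classical all_reals all_analysis.

(* The objective is a rescaled "chain" on R^d,
     - sum_j smoothstep (x_(j-1)) * hump (x_j) + sum_j ramp (x_j)   (x_(-1) = 1),
   whose gradient is bounded below as long as the last coordinate is 0, while a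
   link [j] has zero gradient as long as x_(j-1) = 0.  The even links are given
   to one worker and the odd links to another one.  Coordinates are thus
   discovered one at a time, and each discovery requires that the last
   discovered coordinate survive the sparsification of the message sent to the
   worker owning the next link.  Hence the number of coordinates reached after
   [k] rounds is bounded by a process driven by the multipliers alone,
   whatever the algorithm, whose mean is at most 1 + k p by independence of the
   rounds.  By Markov's inequality, the end of the chain, of length of order
   L delta0 / eps, is reached with probability at most 1/2 during the first
   chat * L delta0 / (p eps) rounds. *)

Set Implicit Arguments.
Unset Strict Implicit.
Unset Printing Implicit Defensive.

Import Order.TTheory GRing.Theory Num.Theory.
Import numFieldNormedType.Exports.

Local Open Scope classical_set_scope.
Local Open Scope ring_scope.

(** * Scalar building blocks *)

Section Smoothstep.
Variable R : realType.
Implicit Types x y : R.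

Definition clamp x : R := Num.min (Num.max x 0) 1.

(** The slope of this cubic vanishes at 0 and 1, so the clamped function is still C^1 with a
    Lipschitz derivative; value and slope both vanish on the negative half-line. *)
Definition smoothstep x : R := 3 * clamp x ^+ 2 - 2 * clamp x ^+ 3.

Definition dsmoothstep x : R := 6 * clamp x * (1 - clamp x).

Lemma clampP x :
  [\/ x <= 0 /\ clamp x = 0, 0 <= x <= 1 /\ clamp x = x | 1 <= x /\ clamp x = 1].
Proof.
rewrite /clamp; case: (leP x 0) => x0; first by constructor 1; rewrite min_l.
case: (leP x 1) => x1; first by constructor 2; rewrite ltW.
by constructor 3; rewrite ltW.
Qed.

Lemma clamp_itv x : 0 <= clamp x <= 1.
Proof. by case: (clampP x) => -[hx ->]; rewrite ?lexx ?ler01. Qed.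

Lemma clamp_lip x y : `|clamp x - clamp y| <= `|x - y|.
Proof.
by case: (clampP x) => -[? ->]; case: (clampP y) => -[? ->];
  rewrite !ler_norml; case: (ler0P (x - y)); lra.
Qed.

Lemma smoothstep_itv x : 0 <= smoothstep x <= 1.
Proof.
rewrite /smoothstep; have /andP[a0 a1] := clamp_itv x; move: (clamp x) a0 a1 => a a0 a1.
have h0 : 0 <= a ^+ 2 * (3 - 2 * a) by rewrite mulr_ge0 ?sqr_ge0//; lra.
have h1 : 0 <= (1 - a) ^+ 2 * (1 + 2 * a) by rewrite mulr_ge0 ?sqr_ge0//; lra.
by apply/andP; split; nra.
Qed.

Lemma dsmoothstep_itv x : 0 <= dsmoothstep x <= 2.
Proof. by rewrite /dsmoothstep; have := clamp_itv x; nra. Qed.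

Lemma smoothstep_le0 x : x <= 0 -> smoothstep x = 0 /\ dsmoothstep x = 0.
Proof.
move=> x0; rewrite /smoothstep /dsmoothstep.
have -> : clamp x = 0 by case: (clampP x) => -[hx ->]; lra.
by split; ring.
Qed.

Lemma smoothstep_ge1 x : 1 <= x -> smoothstep x = 1.
Proof.
move=> x1; rewrite /smoothstep.
have -> : clamp x = 1 by case: (clampP x) => -[hx ->]; lra.
by ring.
Qed.

Lemma smoothstep_lip x y : `|smoothstep x - smoothstep y| <= 2 * `|x - y|.
Proof.
apply: le_trans (ler_wpM2l _ (clamp_lip x y)); last by [].
rewrite /smoothstep; have := clamp_itv x; have := clamp_itv y.
move: (clamp x) (clamp y) => a b /andP[b0 b1] /andP[a0 a1].
have -> : 3 * a ^+ 2 - 2 * a ^+ 3 - (3 * b ^+ 2 - 2 * b ^+ 3) =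
  (3 * (a + b) - 2 * (a ^+ 2 + a * b + b ^+ 2)) * (a - b) by ring.
rewrite normrM ler_wpM2r// ler_norml.
(* The factor equals 2a(1-a) + 2b(1-b) + a(1-b) + b(1-a), hence is nonnegative; the squares [h1] and
   [h2] bound it above. *)
have haa : 0 <= a * (1 - a) by rewrite mulr_ge0// subr_ge0.
have hbb : 0 <= b * (1 - b) by rewrite mulr_ge0// subr_ge0.
have hab : 0 <= a * (1 - b) by rewrite mulr_ge0// subr_ge0.
have hba : 0 <= b * (1 - a) by rewrite mulr_ge0// subr_ge0.
have h1 := sqr_ge0 (a + b - 1); have h2 := sqr_ge0 (a - b).
by apply/andP; split; nra.
Qed.

Lemma dsmoothstep_lip x y : `|dsmoothstep x - dsmoothstep y| <= 6 * `|x - y|.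
Proof.
apply: le_trans (ler_wpM2l _ (clamp_lip x y)); last by [].
rewrite /dsmoothstep; have := clamp_itv x; have := clamp_itv y.
move: (clamp x) (clamp y) => a b hb ha.
have -> : 6 * a * (1 - a) - 6 * b * (1 - b) = (6 * (1 - a - b)) * (a - b) by ring.
rewrite normrM ler_wpM2r// ler_norml; lra.
Qed.

(** The remainder is the polynomial one between the clamped points, at most 3(y-x)^2, minus the
    slope times the change in clamping error, again at most 3(y-x)^2. *)
Lemma smoothstep_taylor x y :
  `|smoothstep y - smoothstep x - dsmoothstep x * (y - x)| <= 6 * (y - x) ^+ 2.
Proof.
rewrite /smoothstep /dsmoothstep.
have hx := clamp_itv x; have hy := clamp_itv y; have := clamp_lip y x.
set a := clamp x in hx *; set b := clamp y in hy *.
rewrite -(ler_pXn2r (_ : 0 < 2)%N) ?nnegrE// !real_normK ?num_real// => hab.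
have -> : 3 * b ^+ 2 - 2 * b ^+ 3 - (3 * a ^+ 2 - 2 * a ^+ 3)
    - 6 * a * (1 - a) * (y - x) =
    (b - a) ^+ 2 * (3 - 2 * b - 4 * a) - 6 * (a * (1 - a) * (y - b - (x - a))).
  by ring.
have h1 : `|(b - a) ^+ 2 * (3 - 2 * b - 4 * a)| <= 3 * (y - x) ^+ 2.
  rewrite normrM ger0_norm ?sqr_ge0// mulrC; apply: ler_pM => //.
    exact: sqr_ge0.
  by rewrite ler_norml; lra.
(* The left-hand side is nonzero only for [x] inside [0,1] and [y] outside. The distances of [x] and
   [y] to the end crossed then add up to |y-x|, which bounds their product. *)
have h2 : `|a * (1 - a) * (y - b - (x - a))| <= 2^-1 * (y - x) ^+ 2.
  have h0 : 0 <= 2^-1 * (y - x) ^+ 2 by have := sqr_ge0 (y - x); lra.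
  rewrite /a /b; case: (clampP x) => -[hx' ->];
    rewrite ?(mul0r, mulr0, subrr, normr0)//.
  have /andP[x0 x1] := hx'; have x01 : 0 <= x * (1 - x) <= 1.
    by apply/andP; split; nra.
  have /andP[x2 x3] := x01.
  case: (clampP y) => -[y0 ->]; rewrite ?(subrr, subr0, mulr0, normr0)//.
  - rewrite normrM ger0_norm// ler0_norm//.
    have h3 : 0 <= x * (x * - y) by rewrite !mulr_ge0// oppr_ge0.
    by have := sqr_ge0 x; have := sqr_ge0 y; nra.
  - rewrite normrM ger0_norm// ger0_norm ?subr_ge0//.
    have h3 : 0 <= (1 - x) * ((1 - x) * (y - 1)) by rewrite !mulr_ge0// subr_ge0.
    by have := sqr_ge0 (1 - x); have := sqr_ge0 (y - 1); nra.
apply: le_trans (ler_normB _ _) _.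
rewrite [ `|6 * _|]normrM (ger0_norm (_ : 0 <= 6))//; lra.
Qed.

(* The affine rescaling makes the slope of [hump] positive on [[-1/2, 1]], where
   [dramp] does not provide a gradient. *)
Definition hump x : R := smoothstep ((x + 1) / 3).

Definition dhump x : R := 3^-1 * dsmoothstep ((x + 1) / 3).

Definition ramp x : R := 2^-1 * Num.min x 0 ^+ 2.

Definition dramp x : R := Num.min x 0.

Lemma hump_itv x : 0 <= hump x <= 1. Proof. exact: smoothstep_itv. Qed.

Lemma dhump_itv x : 0 <= dhump x <= 1.
Proof. by rewrite /dhump; have := dsmoothstep_itv ((x + 1) / 3); lra. Qed.

Lemma hump_lip x y : `|hump x - hump y| <= 2 * `|x - y|.
Proof.
apply: (le_trans (smoothstep_lip _ _)).
have -> : (x + 1) / 3 - (y + 1) / 3 = 3^-1 * (x - y) by field.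
by rewrite normrM gtr0_norm ?invr_gt0//; have := normr_ge0 (x - y); lra.
Qed.

Lemma dhump_lip x y : `|dhump x - dhump y| <= 2 * `|x - y|.
Proof.
rewrite /dhump -mulrBr normrM gtr0_norm ?invr_gt0//.
have := dsmoothstep_lip ((x + 1) / 3) ((y + 1) / 3).
have -> : (x + 1) / 3 - (y + 1) / 3 = 3^-1 * (x - y) by field.
rewrite [ `|3^-1 * _|]normrM gtr0_norm ?invr_gt0//; have := normr_ge0 (x - y); lra.
Qed.

Lemma hump_taylor x y : `|hump y - hump x - dhump x * (y - x)| <= 6 * (y - x) ^+ 2.
Proof.
rewrite /hump /dhump.
have := smoothstep_taylor ((x + 1) / 3) ((y + 1) / 3).
have -> : (y + 1) / 3 - (x + 1) / 3 = 3^-1 * (y - x) by field.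
rewrite mulrCA mulrA => /le_trans; apply.
by have := sqr_ge0 (y - x); rewrite exprMn; lra.
Qed.

Lemma ramp_ge0 x : 0 <= ramp x.
Proof. by rewrite /ramp mulr_ge0 ?invr_ge0 ?sqr_ge0. Qed.

Lemma dramp_lip x y : `|dramp x - dramp y| <= `|x - y|.
Proof.
by rewrite /dramp; case: (leP x 0); case: (leP y 0) => *;
  rewrite !ler_norml; case: (ler0P (x - y)); lra.
Qed.

Lemma ramp_taylor x y : `|ramp y - ramp x - dramp x * (y - x)| <= (y - x) ^+ 2.
Proof.
rewrite /ramp /dramp; have hs := sqr_ge0 (y - x).
have [x0|x0] := leP x 0; have [y0|y0] := leP y 0; rewrite ler_norml.
- by apply/andP; split; nra.
- have h : 0 <= y * - x by rewrite mulr_ge0 ?oppr_ge0// ltW.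
  by have := sqr_ge0 y; have := sqr_ge0 x; move=> *; apply/andP; split; nra.
- have h : 0 <= x * - y by rewrite mulr_ge0 ?oppr_ge0// ltW.
  by have := sqr_ge0 y; have := sqr_ge0 x; move=> *; apply/andP; split; nra.
- by rewrite [0 ^+ 2]expr2 !(mul0r, mulr0) !subr0 hs oppr_le0 hs.
Qed.

(** Up to -1/2, [dramp] alone contributes at least 1/2. On (-1/2,1) the argument of [dsmoothstep]
    lies in (1/6,2/3), where [dhump] is at least 5/18. *)
Lemma dhump_dramp x : x < 1 -> 4^-1 <= dhump x - dramp x.
Proof.
move=> x1; have := dhump_itv x; rewrite /dramp.
move=> /andP[d0 _]; have [x2|x2] := leP x (- 2^-1).
  by rewrite (min_l (_ : x <= 0)); lra.
have m0 : Num.min x 0 <= 0 by rewrite ge_min lexx orbT.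
suff : 4^-1 <= dhump x by lra.
rewrite /dhump /dsmoothstep.
by case: (clampP ((x + 1) / 3)) => -[? ->]; nra.
Qed.

End Smoothstep.

(** * The chain function *)

Section GradientFromTaylor.
Variables (R : realType) (d : nat).
Implicit Types (f : 'rV[R]_d -> R) (x y g h : 'rV[R]_d).

Definition dot g h : R := \sum_(j < d) g ord0 j * h ord0 j.

Lemma dot_is_linear g : linear (dot g).
Proof.
move=> a x y; rewrite /dot scaler_sumr -big_split/=.
by apply: eq_bigr => j _; rewrite !mxE mulrDr mulrCA.
Qed.

HB.instance Definition _ g :=
  GRing.isLinear.Build R 'rV[R]_d R *:%R (dot g) (dot_is_linear g).

Lemma dot_continuous g : continuous (dot g).
Proof.
move=> x; apply: (@cvg_big _ _ +%R 0 xpredT _ _ (nbhs x) _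
  (fun j (h : 'rV[R]_d) => g ord0 j * h ord0 j)) => [|j _].
  exact: add_continuous.
apply: cvgM; first exact: cvg_cst.
exact: coord_continuous.
Qed.

Lemma sqr_sum_le_norm h : \sum_(j < d) h ord0 j ^+ 2 <= d%:R * `|h| ^+ 2.
Proof.
rewrite -[d in d%:R]card_ord mulr_natl -sumr_const; apply: ler_sum => j _.
rewrite -real_normK ?num_real// ler_pXn2r// ?nnegrE//.
rewrite [leRHS]/Num.Def.normr/= mx_normrE; apply/bigmax_geP; right => /=.
by exists (ord0, j).
Qed.

(** A quadratic remainder is o(|h|), so the linear form is the differential. This avoids
    differentiating functions that are only piecewise polynomial. *)
Lemma grad_from_taylor f x g (C : R) :
  (forall y, `|f y - f x - dot g (y - x)|
     <= C * \sum_(j < d) (y - x) ord0 j ^+ 2) ->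
  differentiable f x /\ grad f x = g.
Proof.
move=> fP.
have dE : f \o shift x = cst (f x) + dot g +o_ (0 : 'rV[R]_d) id.
  apply/eqaddoP => e e0.
  (* The factor [d%:R] passes from the squared Euclidean norm to the sup norm; the added 1 makes [M]
     positive. *)
  pose M := `|C| * d%:R + 1.
  have M0 : 0 < M by rewrite ltr_wpDl// mulr_ge0.
  have h0 : \forall h \near (0 : 'rV[R]_d), `|h| <= e / M.
    by apply: (@nbhs0_le _ ('rV[R]_d : normedModType R)); rewrite divr_gt0.
  near=> h.
  have := fP (h + x); rewrite addrK /= => fh.
  rewrite [X in `|X|](_ : _ = f (h + x) - f x - dot g h); last first.
    by rewrite !fctE /= opprD addrA.
  have hM : `|h| <= e / M.
    by near: h; exact: h0.
  apply: (le_trans fh); apply: (@le_trans _ _ (M * `|h| ^+ 2)).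
    apply: (@le_trans _ _ (`|C| * (d%:R * `|h| ^+ 2))); last first.
      by rewrite mulrA ler_wpM2r// ?sqr_ge0// /M lerDl.
    apply: le_trans (ler_wpM2l _ (sqr_sum_le_norm h)) => //.
    by rewrite ler_wpM2r ?ler_norm// sumr_ge0// => j _; rewrite sqr_ge0.
  by rewrite expr2 mulrA ler_wpM2r// -ler_pdivlMl// mulrC.
have ddot := diff_unique (@dot_continuous g) dE.
have df : differentiable f x.
  by apply/diff_locallyP; rewrite ddot; split => //; exact: dot_continuous.
split=> //; apply/rowP => j; rewrite mxE deriveE// ddot.
rewrite -[LHS]/(dot g (delta_mx ord0 j)) /dot (bigD1 j)//=.
rewrite !mxE !eqxx mulr1 big1 ?addr0// => i ij.
by rewrite mxE (negbTE ij) andbF mulr0.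
Unshelve. all: by end_near. Qed.

End GradientFromTaylor.

(** * Smoothness, lower bounds and support of the chain *)

Section Chain.
Variable R : realType.

(** Product rule with remainder: the remainders of the factors are multiplied by numbers in [0,1],
    and the product of the two increments is bounded by the Lipschitz constants and the AM-GM
    inequality. *)
Lemma smoothstep_hump_taylor (u v u' v' : R) :
  `|smoothstep u' * hump v' - smoothstep u * hump v
    - (dsmoothstep u * hump v * (u' - u) + smoothstep u * dhump v * (v' - v))|
  <= 8 * ((u' - u) ^+ 2 + (v' - v) ^+ 2).
Proof.
have /andP[s0 s1] := smoothstep_itv u; have /andP[b0 b1] := hump_itv v.
have hs := smoothstep_taylor u u'; have hb := hump_taylor v v'.
have hsl := smoothstep_lip u' u; have hbl := hump_lip v' v.
set A' := smoothstep u' in hs hsl *; set A := smoothstep u in s0 s1 hs hsl *.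
set B' := hump v' in hb hbl *; set B := hump v in b0 b1 hb hbl *.
have -> : A' * B' - A * B - (dsmoothstep u * B * (u' - u) + A * dhump v * (v' - v)) =
    (A' - A - dsmoothstep u * (u' - u)) * B
    + A * (B' - B - dhump v * (v' - v)) + (A' - A) * (B' - B) by ring.
have h1 : `|(A' - A - dsmoothstep u * (u' - u)) * B| <= 6 * (u' - u) ^+ 2.
  rewrite normrM -[leRHS]mulr1 ler_pM//; by rewrite ger0_norm.
have h2 : `|A * (B' - B - dhump v * (v' - v))| <= 6 * (v' - v) ^+ 2.
  rewrite normrM -[leRHS]mul1r ler_pM//; by rewrite ger0_norm.
have h3 : `|(A' - A) * (B' - B)| <= 2 * ((u' - u) ^+ 2 + (v' - v) ^+ 2).
  rewrite normrM; apply: (le_trans (ler_pM _ _ hsl hbl)) => //.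
  rewrite -(real_normK (num_real (u' - u))) -(real_normK (num_real (v' - v))).
  by have := sqr_ge0 (`|u' - u| - `|v' - v|); nra.
apply: le_trans (ler_normD _ _) _; have := ler_normD
  ((A' - A - dsmoothstep u * (u' - u)) * B) (A * (B' - B - dhump v * (v' - v))).
lra.
Qed.

Variable d : nat.
Implicit Types (x y : 'rV[R]_d) (c : nat -> R) (h : R).

(** Natural indices with default 0 let a link refer to its neighbouring coordinates without range
    proofs. *)
Definition ext x (j : nat) : R := oapp (x ord0) 0 (insub j).

Definition prv x (j : nat) : R := if j is j'.+1 then ext x j' else 1.

Lemma ext_ord x (i : 'I_d) : ext x i = x ord0 i.
Proof. by rewrite /ext valK. Qed.

Lemma ext_geq x j : (d <= j)%N -> ext x j = 0.
Proof. by move=> dj; rewrite /ext insubN// -leqNgt. Qed.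

Lemma extB x y j : ext (x - y) j = ext x j - ext y j.
Proof. by rewrite /ext; case: insub => [i|]/=; rewrite ?subr0// !mxE. Qed.

Lemma extZ b x j : ext (b *: x) j = b * ext x j.
Proof. by rewrite /ext; case: insub => [i|]/=; rewrite ?mulr0// !mxE. Qed.

(* The coordinate [j = d] is a dummy one, equal to 0; its link only saves a
   case distinction in the derivative at the last coordinate. *)
Definition chain c h x : R :=
  h * \sum_(j < d) ramp (ext x j)
  - \sum_(j < d.+1) c j * (smoothstep (prv x j) * hump (ext x j)).

Definition dchain c h x (i : nat) : R :=
  h * dramp (ext x i)
  - c i * (smoothstep (prv x i) * dhump (ext x i))
  - c i.+1 * (dsmoothstep (ext x i) * hump (ext x i.+1)).

Definition chain_grad c h x : 'rV[R]_d := \row_i dchain c h x i.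

Lemma sum_ext_sqr x : \sum_(j < d.+1) ext x j ^+ 2 = \sum_(j < d) x ord0 j ^+ 2.
Proof.
rewrite big_ord_recr/= ext_geq// expr0n addr0.
by apply: eq_bigr => j _; rewrite ext_ord.
Qed.

Lemma sum_prv_sqr x y :
  \sum_(j < d.+1) (prv x j - prv y j) ^+ 2 = \sum_(j < d) (x - y) ord0 j ^+ 2.
Proof.
rewrite big_ord_recl/= subrr expr0n add0r.
by apply: eq_bigr => j _; rewrite -extB ext_ord.
Qed.

(** Regroups the partial derivatives by link instead of by coordinate. The boundary terms vanish
    because [prv] is constant at index 0 and the dummy coordinate is always 0. *)
Lemma dot_chain_grad c h x y :
  dot (chain_grad c h x) (y - x) =
  h * \sum_(j < d) dramp (ext x j) * (ext y j - ext x j)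
  - \sum_(j < d.+1) c j * (dsmoothstep (prv x j) * hump (ext x j) * (prv y j - prv x j))
  - \sum_(j < d.+1) c j * (smoothstep (prv x j) * dhump (ext x j) * (ext y j - ext x j)).
Proof.
rewrite big_ord_recl/= subrr !mulr0 add0r.
rewrite [X in _ - _ - X]big_ord_recr/= !(ext_geq _ (leqnn d)) subrr !mulr0 addr0.
rewrite mulr_sumr -!sumrB; apply: eq_bigr => j _.
by rewrite !mxE /dchain /fintype.bump/= !ext_ord; ring.
Qed.

(** Each coordinate enters one ramp and at most two links, with remainder constants 1 and 8: 17 = 1
    + 8 + 8. *)
Lemma chain_taylor c h x y :
  (forall j, `|c j| <= 1) -> `|h| <= 1 ->
  `|chain c h y - chain c h x - dot (chain_grad c h x) (y - x)|
    <= 17 * \sum_(j < d) (y - x) ord0 j ^+ 2.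
Proof.
move=> c1 h1; rewrite dot_chain_grad /chain.
pose E1 j := ramp (ext y j) - ramp (ext x j) - dramp (ext x j) * (ext y j - ext x j).
pose E2 j := smoothstep (prv y j) * hump (ext y j) - smoothstep (prv x j) * hump (ext x j)
  - (dsmoothstep (prv x j) * hump (ext x j) * (prv y j - prv x j)
      + smoothstep (prv x j) * dhump (ext x j) * (ext y j - ext x j)).
rewrite [X in `|X|](_ : _ = h * \sum_(j < d) E1 j - \sum_(j < d.+1) c j * E2 j); last first.
  rewrite /E1 !sumrB [X in _ = _ - X](_ : _ =
      \sum_(j < d.+1) c j * (smoothstep (prv y j) * hump (ext y j))
    - \sum_(j < d.+1) c j * (smoothstep (prv x j) * hump (ext x j))
    - \sum_(j < d.+1) c j * (dsmoothstep (prv x j) * hump (ext x j) * (prv y j - prv x j))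
    - \sum_(j < d.+1) c j * (smoothstep (prv x j) * dhump (ext x j) * (ext y j - ext x j))).
    by ring.
  by rewrite -!sumrB; apply: eq_bigr => j _; rewrite /E2; ring.
apply: le_trans (ler_normB _ _) _.
have -> : 17 * \sum_(j < d) (y - x) ord0 j ^+ 2 =
    \sum_(j < d) (y - x) ord0 j ^+ 2 + 8 * (\sum_(j < d) (y - x) ord0 j ^+ 2
      + \sum_(j < d) (y - x) ord0 j ^+ 2) by ring.
apply: lerD.
  rewrite normrM -[leRHS]mul1r ler_pM//.
  apply: (le_trans (ler_norm_sum _ _ _)); apply: ler_sum => j _.
  by apply: (le_trans (ramp_taylor _ _)); rewrite -extB ext_ord.
rewrite -{1}(sum_prv_sqr y x) -(sum_ext_sqr (y - x)) -big_split/= mulr_sumr.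
apply: (le_trans (ler_norm_sum _ _ _)); apply: ler_sum => j _.
rewrite normrM -[leRHS]mul1r ler_pM// extB.
exact: smoothstep_hump_taylor.
Qed.

(** Only three consecutive coordinates are involved; the scalar bounds add up to 2, 9 and 4 for
    them. *)
Lemma dchain_lip c h x y i :
  (forall j, `|c j| <= 1) -> `|h| <= 1 ->
  `|dchain c h x i - dchain c h y i| <=
  9 * (`|prv x i - prv y i| + `|ext (x - y) i| + `|ext (x - y) i.+1|).
Proof.
move=> c1 h1; rewrite !extB /dchain.
set u := prv x i; set u' := prv y i; set v := ext x i; set v' := ext y i.
set w := ext x i.+1; set w' := ext y i.+1.
have -> : h * dramp v - c i * (smoothstep u * dhump v) - c i.+1 * (dsmoothstep v * hump w)
   - (h * dramp v' - c i * (smoothstep u' * dhump v') - c i.+1 * (dsmoothstep v' * hump w'))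
   = h * (dramp v - dramp v')
     - c i * ((smoothstep u - smoothstep u') * dhump v
              + smoothstep u' * (dhump v - dhump v'))
     - c i.+1 * ((dsmoothstep v - dsmoothstep v') * hump w
              + dsmoothstep v' * (hump w - hump w')) by ring.
have A : `|h * (dramp v - dramp v')| <= `|v - v'|.
  by rewrite normrM -[leRHS]mul1r ler_pM ?dramp_lip.
have B : `|c i * ((smoothstep u - smoothstep u') * dhump v
              + smoothstep u' * (dhump v - dhump v'))| <= 2 * `|u - u'| + 2 * `|v - v'|.
  rewrite normrM -[leRHS]mul1r ler_pM//; apply: (le_trans (ler_normD _ _)).
  have /andP[? ?] := dhump_itv v; have /andP[? ?] := smoothstep_itv u'.
  apply: lerD; rewrite normrM.
    by rewrite -[leRHS]mulr1 ler_pM ?smoothstep_lip// ger0_norm.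
  by rewrite -[leRHS]mul1r ler_pM ?dhump_lip// ger0_norm.
have C : `|c i.+1 * ((dsmoothstep v - dsmoothstep v') * hump w
              + dsmoothstep v' * (hump w - hump w'))| <= 6 * `|v - v'| + 4 * `|w - w'|.
  rewrite normrM -[leRHS]mul1r ler_pM//; apply: (le_trans (ler_normD _ _)).
  have /andP[? ?] := hump_itv w; have /andP[? ?] := dsmoothstep_itv v'.
  apply: lerD; rewrite normrM.
    by rewrite -[leRHS]mulr1 ler_pM ?dsmoothstep_lip// ger0_norm.
  have -> : 4 = 2 * 2 :> R by ring.
  by rewrite -mulrA ler_pM ?hump_lip// ger0_norm.
apply: (le_trans (ler_normB _ _)).
have := ler_normB (h * (dramp v - dramp v')) (c i * ((smoothstep u - smoothstep u') * dhump v
              + smoothstep u' * (dhump v - dhump v'))).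
by have := normr_ge0 (u - u'); have := normr_ge0 (v - v'); have := normr_ge0 (w - w'); lra.
Qed.

Lemma enorm_sqr x : enorm x ^+ 2 = \sum_(j < d) x ord0 j ^+ 2.
Proof. by rewrite sqr_sqrtr// sumr_ge0// => j _; exact: sqr_ge0. Qed.

Lemma enorm_ge0 x : 0 <= enorm x. Proof. exact: sqrtr_ge0. Qed.

Lemma enormZ b x : enorm (b *: x) = `|b| * enorm x.
Proof.
apply/eqP; rewrite -(eqrXn2 (_ : 0 < 2)%N) ?mulr_ge0 ?enorm_ge0//.
rewrite exprMn !enorm_sqr real_normK ?num_real// mulr_sumr; apply/eqP.
by apply: eq_bigr => j _; rewrite mxE exprMn.
Qed.

(** Squaring a sum of three terms costs a factor 3, so 9^2 * 3 = 243, and each coordinate is counted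
    at most three times: 243 * 3 = 27^2. *)
Lemma chain_grad_lip c h x y :
  (forall j, `|c j| <= 1) -> `|h| <= 1 ->
  enorm (chain_grad c h x - chain_grad c h y) <= 27 * enorm (x - y).
Proof.
move=> c1 h1; rewrite -(ler_pXn2r (_ : 0 < 2)%N) ?nnegrE ?mulr_ge0 ?enorm_ge0//.
rewrite exprMn !enorm_sqr.
pose U j := (prv x j - prv y j) ^+ 2; pose V j := ext (x - y) j ^+ 2.
apply: (@le_trans _ _ (\sum_(j < d) 243 * (U j + V j + V j.+1))).
  apply: ler_sum => j _; rewrite !mxE -real_normK ?num_real//.
  have := dchain_lip x y j c1 h1.
  rewrite /U /V -(real_normK (num_real (prv x j - prv y j))).
  rewrite -(real_normK (num_real (ext (x - y) j))).
  rewrite -(real_normK (num_real (ext (x - y) j.+1))).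
  move: `|prv x j - prv y j| `|ext (x - y) j| `|ext (x - y) j.+1| => a b e hl.
  apply: (@le_trans _ _ ((9 * (a + b + e)) ^+ 2)).
    by rewrite ler_pXn2r// ?nnegrE//; apply: le_trans hl.
  by have := sqr_ge0 (a - b); have := sqr_ge0 (a - e); have := sqr_ge0 (b - e); nra.
rewrite -mulr_sumr !big_split/=.
have -> : \sum_(j < d) V j = \sum_(j < d) (x - y) ord0 j ^+ 2.
  by apply: eq_bigr => j _; rewrite /V ext_ord.
have hU : \sum_(j < d) U j <= \sum_(j < d) (x - y) ord0 j ^+ 2.
  by rewrite -sum_prv_sqr big_ord_recr/= lerDl sqr_ge0.
have hV : \sum_(j < d) V j.+1 <= \sum_(j < d) (x - y) ord0 j ^+ 2.
  by rewrite -(sum_ext_sqr (x - y)) big_ord_recl/= lerDr sqr_ge0.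
lra.
Qed.

Lemma chain0_le c : (forall j, 0 <= c j) -> chain c 1 0 <= 0.
Proof.
move=> c0; rewrite /chain big1 ?mulr0 ?sub0r ?oppr_le0; last first.
  move=> j _; rewrite ext_ord mxE /ramp min_l//.
  by rewrite expr0n mulr0.
apply: sumr_ge0 => j _; rewrite !mulr_ge0//.
  by have /andP[] := smoothstep_itv (prv 0 j).
by have /andP[] := hump_itv (ext 0 j).
Qed.

Lemma chain_ge c x : (forall j, 0 <= c j <= 1) -> - d.+1%:R <= chain c 1 x.
Proof.
move=> c1; rewrite /chain mul1r -[leLHS]add0r lerB ?sumr_ge0//.
  by move=> j _; exact: ramp_ge0.
rewrite -[d.+1 in leRHS]card_ord -sumr_const; apply: ler_sum => j _.
have /andP[? ?] := c1 j; have /andP[? ?] := smoothstep_itv (prv x j).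
by have /andP[? ?] := hump_itv (ext x j); rewrite !mulr_ile1// mulr_ge0.
Qed.

(* At the first coordinate below 1 the incoming link is fully active, and all
   other terms of the partial derivative have the same sign. *)
Lemma chain_stuck x : (0 < d)%N -> ext x d.-1 = 0 ->
  16^-1 <= enorm (chain_grad (fun=> 1) 1 x) ^+ 2.
Proof.
move=> d0 xd.
have ex1 : exists j, ext x j < 1 by exists d.-1; rewrite xd ltr01.
have md : (ex_minn ex1 < d)%N.
  case: ex_minnP => m _ /(_ d.-1); rewrite xd ltr01 => /(_ isT) md.
  by rewrite (leq_ltn_trans md)// prednK.
have dm : dchain (fun=> 1) 1 x (ex_minn ex1) <= - 4^-1.
  case: ex_minnP => m xm mmin; rewrite /dchain smoothstep_ge1; last first.
    case: m {xm} mmin => [|m] mmin //=; rewrite leNgt; apply/negP => /mmin.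
    by rewrite ltnn.
  have := dhump_dramp xm; have /andP[s0 _] := dsmoothstep_itv (ext x m).
  have /andP[b0 _] := hump_itv (ext x m.+1).
  have : 0 <= dsmoothstep (ext x m) * hump (ext x m.+1) by rewrite mulr_ge0.
  by rewrite !mul1r; lra.
rewrite enorm_sqr (bigD1 (Ordinal md))//= mxE/=.
have : 16^-1 <= dchain (fun=> 1) 1 x (ex_minn ex1) ^+ 2 by nra.
move=> /le_trans; apply; rewrite lerDl sumr_ge0// => j _; exact: sqr_ge0.
Qed.

(** For i >= r, the value 0 of coordinate i flattens its ramp and its outgoing link. Its incoming
    link is absent if i = r, and is switched off by the zero coordinate i - 1 if i > r. *)
Lemma chain_grad_supp c h x (r : nat) :
  c r = 0 -> supp x `<=` [set j | (j < r)%N] ->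
  supp (chain_grad c h x) `<=` [set j | (j < r)%N].
Proof.
move=> cr xr i; rewrite /supp/= mxE; apply: contraNT; rewrite -leqNgt => ri.
have x0 j : (r <= j)%N -> ext x j = 0.
  move=> rj; rewrite /ext; case: insubP => //= k _ kj.
  by apply/eqP; apply: contraTT rj => /xr/=; rewrite kj -ltnNge.
have [s0 ds0] := smoothstep_le0 (lexx (0 : R)).
rewrite /dchain (x0 _ ri) ds0 mul0r mulr0 subr0 /dramp minxx mulr0 sub0r oppr_eq0.
have [->|ir] := eqVneq (i : nat) r; first by rewrite cr mul0r.
have : (r < i)%N by rewrite ltn_neqAle eq_sym ir.
by case: (i : nat) => // k rk; rewrite /= x0// s0 mul0r mulr0.
Qed.

(** The weights [c] and [h] let one formula cover both the objective, with all weights 1, and the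
    local functions, with 0-1 weights selecting links and ramps. *)
Definition scaled_chain (a b : R) c h x : R := a * chain c h (b *: x).

Lemma grad_scaled_chain a b c h x : (forall j, `|c j| <= 1) -> `|h| <= 1 ->
  differentiable (scaled_chain a b c h) x /\
  grad (scaled_chain a b c h) x = (a * b) *: chain_grad c h (b *: x).
Proof.
move=> c1 h1; apply: (@grad_from_taylor _ _ _ _ _ (`|a| * (17 * b ^+ 2))) => y.
have := chain_taylor (b *: x) (b *: y) c1 h1; rewrite -scalerBr => ht.
have -> : scaled_chain a b c h y - scaled_chain a b c h x
    - dot ((a * b) *: chain_grad c h (b *: x)) (y - x) =
    a * (chain c h (b *: y) - chain c h (b *: x)
      - dot (chain_grad c h (b *: x)) (b *: (y - x))).
  rewrite /scaled_chain !mulrBr; congr (_ - _); rewrite /dot mulr_sumr.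
  by apply: eq_bigr => j _; rewrite !mxE; ring.
rewrite normrM -mulrA -[17 * _ * _]mulrA ler_wpM2l//; apply: (le_trans ht).
rewrite ler_wpM2l// mulr_sumr; apply: ler_sum => j _.
by rewrite !mxE exprMn.
Qed.

End Chain.

(** * Progress of the protocol *)

Section Progress.

(** The count starts at 1 because the first link is active at the origin: its owner can discover
    coordinate 0 without receiving anything. *)
Fixpoint progress (act : nat -> nat -> bool) (k : nat) : nat :=
  if k is k'.+1 then (act k' (progress act k') + progress act k')%N else 1%N.

Lemma progress_mono act : {homo progress act : k m / (k <= m)%N}.
Proof. by apply: homo_leq leqnn leq_trans _ => k /=; exact: leq_addl. Qed.

Lemma progress_gt0 act k : (0 < progress act k)%N.
Proof. exact: (@progress_mono act 0). Qed.

Variables (R : realType) (n : nat) (A : algorithm R n) (d : nat).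
Variables (fs : 'I_n -> 'rV[R]_d -> R) (e : nat -> 'I_n -> nat -> R).
Variable owner : nat -> 'I_n.

Hypothesis A_zr : zero_respecting A.
Hypothesis fs_diff : forall i x, differentiable (fs i) x.
Hypothesis owner_neq : forall r, owner r.+1 != owner r.
Hypothesis fs_supp : forall i r (x : 'rV[R]_d), i != owner r ->
  supp x `<=` [set j | (j < r)%N] -> supp (grad (fs i) x) `<=` [set j | (j < r)%N].

Let G i := grad (fs i).
Let q k := progress (fun k r => e k (owner r) r.-1 != 0) k.

(* When [q] coordinates may have been reached, only the worker [owner q] can
   discover the next one, and only from a message with a nonzero coordinate
   [q - 1]; if it has not received such a message, then it is confined to the
   coordinates below [q - 1], a level that it does not own. *)
Lemma message_supp m i :
  supp (message A G e m i) `<=` [set j : 'I_d | (j < q m.+1)%N].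
Proof.
elim/ltn_ind: m i => m IH i.
have q_mono a b : (a <= b)%N -> (q a <= q b)%N by exact: progress_mono.
have sparse_supp l (j : 'I_d) : (l <= m)%N -> sparse_vec A G e l i ord0 j != 0 ->
    (j < q l)%N /\ e l i j != 0.
  move=> lm; rewrite mxE mulf_eq0 negb_or => /andP[sj ej]; split=> //.
  have [_ /(_ j sj) + _] := A_zr e fs_diff l i.
  move=> -[/= p pl [w _]] /(IH _ (leq_trans pl lm)) /= jq.
  exact: leq_trans jq (q_mono _ _ pl).
pose r := if i == owner (q m.+1) then (q m.+1).-1 else q m.+1.
have q0 : (0 < q m.+1)%N by exact: progress_gt0.
have rq : (r <= q m.+1)%N by rewrite /r; case: ifP; rewrite ?leq_pred.
have ir : i != owner r.
  rewrite /r; case: ifP => [/eqP->|/negbT//].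
  by rewrite -[in X in X != _](prednK q0) owner_neq.
have sparse_r l (j : 'I_d) : (l <= m)%N -> sparse_vec A G e l i ord0 j != 0 ->
    (j < r)%N.
  move=> lm /(sparse_supp _ _ lm)[jq ej].
  have ql : (q l <= q l.+1 <= q m.+1)%N by rewrite !q_mono.
  rewrite /r; case: ifP => [/eqP iq|_]; last by lia.
  have [ljq|jq'] := ltnP j (q m.+1).-1; first by [].
  (* Otherwise worker [i], owner of the next link, received the last reachable coordinate at round
     [l]. The count was then already [q m.+1], and the nonzero multiplier would push it further. *)
  have qlm : q l = q m.+1 by lia.
  have jE : nat_of_ord j = (q l).-1 by lia.
  have : q l.+1 = (q l).+1.
    by rewrite /q/= -/(q l) qlm -iq -qlm -jE ej.
  lia.
have [_ _ [ghat [ghat_supp /subset_trans]]] := A_zr e fs_diff m i.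
apply=> j [t _]; suff : supp (ghat t) `<=` [set j : 'I_d | (j < r)%N].
  by move=> /[apply] /= jr; exact: leq_trans jr rq.
elim/ltn_ind: t => t IHt k /ghat_supp[[l /= lm sk]|[s /= st]].
  exact: sparse_r sk.
by apply: fs_supp => //; exact: IHt.
Qed.

Lemma server_point_supp k :
  supp (server_point A G e k) `<=` [set j : 'I_d | (j < q k)%N].
Proof.
have [+ _ _] := A_zr e fs_diff k (owner 0) => /subset_trans; apply.
move=> j [/= p pk [w _]] /message_supp/= jq; apply: leq_trans jq _.
exact: progress_mono.
Qed.

End Progress.

(** * Law of the progress *)

Section ProgressProbability.
Context {dd : measure_display} {T : measurableType dd} {R : realType}.
Variables (P : probability T R) (S : nat -> set (set T)).
Hypothesis S_measurable : forall k E, S k E -> measurable E.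
Hypothesis S_setC : forall k E, S k E -> S k (~` E).
Hypothesis S_indep : mutually_independent P S.

(** One event for each of the consecutive rounds l, l+1, ...: a finite piece of the future. *)
Fixpoint in_levels (l : nat) (Es : seq (set T)) : Prop :=
  if Es is E :: Es' then S l E /\ in_levels l.+1 Es' else True.

Lemma in_levels_nth l Es i : in_levels l Es -> (i < size Es)%N ->
  S (l + i) (nth setT Es i).
Proof.
elim: Es l i => // E Es IH l [|i] /= [SE /IH HEs]; first by rewrite addn0.
by rewrite ltnS addnS -addSn; exact: HEs.
Qed.

Lemma in_levels_measurable l Es : in_levels l Es ->
  measurable (\big[setI/setT]_(E <- Es) E).
Proof.
elim: Es l => [|E Es IH] l /=; first by rewrite big_nil.
by move=> [/S_measurable mE /IH mEs]; rewrite big_cons; exact: measurableI.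
Qed.

(** Testing only against finite products of single-round events lets independence pass from round to
    round by elementary set operations, without a sigma-algebra of the past. *)
Definition indep_of_future (l : nat) (X : set T) : Prop := measurable X /\
  forall Es, in_levels l Es ->
    P (X `&` \big[setI/setT]_(E <- Es) E) = (P X * \prod_(E <- Es) P E)%E.

Lemma indep_of_futureT : indep_of_future 0 setT.
Proof.
split=> // Es /in_levels_nth SEs; rewrite setTI probability_setT mul1e.
pose K := seq_fset tt (iota 0 (size Es)).
have KE k : (k \in K) = (k < size Es)%N by rewrite seq_fsetE mem_iota.
have := S_indep (K := K) (E := fun k => nth setT Es k).
have K_perm : perm_eq K (iota 0 (size Es)).
  by rewrite (perm_trans (seq_fset_perm tt _))// undup_id// iota_uniq.
have iotaE : iota 0 (size Es) = index_iota 0 (size Es) by rewrite /index_iota subn0.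
rewrite (perm_big _ K_perm)/= iotaE -(big_nth setT xpredT (fun E => P E)).
move=> <-; last by move=> k; rewrite KE => /SEs.
congr (P _); rewrite (big_nth setT) big_mkord -bigcap_mkord.
by apply: eq_bigcapl; split=> k /=; rewrite KE.
Qed.

Lemma indep_of_future0 l : indep_of_future l set0.
Proof. by split=> // Es _; rewrite set0I measure0 mul0e. Qed.

(** The event [E] is put at the head of the list of future events; the list reduced to [E] gives the
    product formula. *)
Lemma indep_of_futureI l X E : indep_of_future l X -> S l E ->
  P (X `&` E) = (P X * P E)%E /\ indep_of_future l.+1 (X `&` E).
Proof.
move=> [mX iX] SE; have PXE : P (X `&` E) = (P X * P E)%E.
  by have := iX [:: E]; rewrite !big_seq1; apply.
split=> //; split=> [|Es SEs]; first exact: measurableI (S_measurable SE).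
by have := iX (E :: Es); rewrite !big_cons setIA PXE muleA; apply.
Qed.

Lemma indep_of_futureU l X Y : indep_of_future l X -> indep_of_future l Y ->
  X `&` Y = set0 -> indep_of_future l (X `|` Y).
Proof.
move=> [mX iX] [mY iY] XY; split=> [|Es SEs]; first exact: measurableU.
have mEs := in_levels_measurable SEs.
rewrite setIUl !measureU//; [|exact: measurableI|exact: measurableI|].
  by rewrite ge0_muleDl//; congr (_ + _)%E; [exact: iX|exact: iY].
by rewrite setIACA XY set0I.
Qed.

Variables (B : nat -> nat -> set T) (p : R).
Hypothesis B_level : forall k r, S k (B k r).
Hypothesis B_prob : forall k r, (P (B k r) <= p%:E)%E.

Definition random_progress (k : nat) (w : T) : nat :=
  progress (fun k r => w \in B k r) k.

Lemma random_progressS k w :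
  random_progress k.+1 w = ((w \in B k (random_progress k w)) + random_progress k w)%N.
Proof. by []. Qed.

(** The value r after one more round arises in two disjoint ways: from r without success, or from r
    - 1 with success. Each combines a level set at time k with an event of round k. *)
Lemma random_progress_indep k r :
  indep_of_future k [set w | random_progress k w = r].
Proof.
elim: k r => [|k IH] r.
  have [->|r1] := eqVneq r 1%N.
    rewrite [X in indep_of_future _ X](_ : _ = setT); last by apply/seteqP; split.
    exact: indep_of_futureT.
  rewrite [X in indep_of_future _ X](_ : _ = set0); last first.
    by apply/seteqP; split=> // w /= rw; rewrite -rw in r1.
  exact: indep_of_future0.
rewrite [X in indep_of_future _ X](_ : _ =
    ([set w | random_progress k w = r] `&` ~` B k r) `|`
    (if r is r'.+1 then [set w | random_progress k w = r'] `&` B k r' else set0)).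
  apply: indep_of_futureU.
  - by have [] := indep_of_futureI (IH r) (S_setC (B_level k r)).
  - case: r => [|r]; first exact: indep_of_future0.
    by have [] := indep_of_futureI (IH r) (B_level k r).
  - case: r => [|r]; first by rewrite setI0.
    by apply/seteqP; split=> // w /= [[-> _] [/eqP]]; rewrite (gtn_eqF (ltnSn r)).
apply/seteqP; split=> w /=; rewrite random_progressS.
  case: (boolP (w \in B k _)) => [/set_mem Bw <-|/negP nBw <-].
    by right; rewrite add1n.
  by left; rewrite add0n; split=> // /mem_set.
move=> [[-> nBw]|]; first by rewrite memNset.
by case: r => // r [-> /mem_set ->].
Qed.

Lemma measurable_progress_gt k r : measurable [set w | (r < random_progress k w)%N].
Proof.
rewrite [X in measurable X](_ : _ =
    \bigcup_(m in [set m | (r < m)%N]) [set w | random_progress k w = m]).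
  by apply: bigcup_measurable => m _; have [] := random_progress_indep k m.
apply/seteqP; split=> w /=; first by move=> h; exists (random_progress k w).
by move=> [m /= rm ->].
Qed.

(** The sum of tails is the mean of the count truncated at [r]. Round k raises the m-th tail by at
    most p P(count = m), by independence, and these level sets are disjoint. *)
Lemma sum_progress_gt k r :
  (\sum_(m < r) P [set w | (m < random_progress k w)%N] <= (1 + k%:R * p)%:E)%E.
Proof.
have p0 : 0 <= p by rewrite -lee_fin; apply: le_trans (B_prob 0 0).
elim: k => [|k IH].
  rewrite mul0r addr0; case: r => [|r]; first by rewrite big_ord0.
  rewrite big_ord_recl/= big1 ?adde0 ?probability_le1//.
    exact: (@measurable_progress_gt 0 0).
  move=> m _; rewrite [X in P X](_ : _ = set0) ?measure0//.
  by apply/seteqP; split.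
pose Q m := [set w | random_progress k w = m].
have mQ m : measurable (Q m) by have [] := random_progress_indep k m.
have mB m : measurable (B k m) by exact: S_measurable (B_level k m).
apply: (@le_trans _ _ (\sum_(m < r) (P [set w | (m < random_progress k w)%N]
    + p%:E * P (Q m)))%E).
  apply: lee_sum => m _.
  have [PQB _] := indep_of_futureI (random_progress_indep k m) (B_level k m).
  apply: (@le_trans _ _ (P [set w | (m < random_progress k w)%N] + P (Q m `&` B k m))%E).
    apply: le_trans (measureU2 _ _ _) => //.
    - apply: le_measure; rewrite ?inE.
      + exact: measurable_progress_gt.
      + by apply: measurableU; [exact: measurable_progress_gt|exact: measurableI].
      move=> w /=; rewrite random_progressS.
      case: (boolP (w \in B k _)) => [/set_mem Bw|_]; last by left.
      rewrite add1n ltnS leq_eqVlt => /predU1P[mE|]; last by left.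
      by right; rewrite /Q/= mE.
    - exact: measurable_progress_gt.
    - exact: measurableI.
  by rewrite leeD2l// PQB muleC lee_wpmul2r.
rewrite big_split/= -ge0_sume_distrr//.
have -> : (1 + k.+1%:R * p)%:E = ((1 + k%:R * p)%:E + p%:E)%E.
  by rewrite -EFinD -natr1; congr _%:E; ring.
apply: leeD => //; rewrite -[leRHS]mule1 lee_wpmul2l ?lee_fin//.
rewrite -measure_semi_additive_ord_I//.
- by apply: probability_le1; apply: bigsetU_measurable.
- by move=> i j _ _ [w [/= <- <-]].
- exact: bigsetU_measurable.
Qed.

(** Tails decrease, so each of the first [r.+1] of them is at least the last one. *)
Lemma progress_markov k r :
  ((r.+1)%:R%:E * P [set w | (r < random_progress k w)%N] <= (1 + k%:R * p)%:E)%E.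
Proof.
apply: le_trans (sum_progress_gt k r.+1).
have -> : (r.+1%:R%:E * P [set w | (r < random_progress k w)%N] =
    \sum_(m < r.+1) P [set w | (r < random_progress k w)%N])%E.
  by rewrite sumr_const card_ord mule_natl.
apply: lee_sum => m _; apply: le_measure; rewrite ?inE; try exact: measurable_progress_gt.
by move=> w /=; apply: leq_ltn_trans; rewrite -ltnS.
Qed.

End ProgressProbability.

(* The maps of an algorithm are arbitrary, so [f] may be non-measurable; its
   integral is then a lower integral, a supremum over simple functions below. *)
Lemma expectation_ge_indic (dd : measure_display) (T : measurableType dd)
    (R : realType) (P : probability T R) (f : T -> R) (D : set T) (v : R) :
  measurable D -> 0 <= v -> (forall w, 0 <= f w) -> (forall w, D w -> v <= f w) ->
  (v%:E * P D <= 'E_P[f])%E.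
Proof.
move=> mD v0 f0 Df; rewrite unlock ge0_integralTE//.
apply: ereal_sup_ubound; exists (scale_nnsfun (indic_nnsfun R mD) v0) => /=.
  move=> w; rewrite lee_fin [leLHS](_ : _ = v * (w \in D)%:R)//; case: (boolP (w \in D)) => wD.
    by rewrite mulr1 Df//; exact: set_mem.
  by rewrite mulr0.
transitivity (v%:E * sintegral P (\1_D : T -> R))%E.
  exact: (sintegralrM P v (indic_nnsfun R mD)).
by rewrite sintegral_indic.
Qed.

(** * The lower bound *)

Lemma sum_scaled_chain (R : realType) (d n : nat) (a b : R)
    (c : 'I_n -> nat -> R) (h : 'I_n -> R) (x : 'rV[R]_d) :
  \sum_(i < n) scaled_chain a b (c i) (h i) x =
  scaled_chain a b (fun j => \sum_(i < n) c i j) (\sum_(i < n) h i) x.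
Proof.
rewrite /scaled_chain /chain -mulr_sumr sumrB -mulr_suml exchange_big/=.
by congr (_ * (_ - _)); apply: eq_bigr => j _; rewrite mulr_suml.
Qed.

Lemma sum_indicator (R : realType) (n k : nat) : (k < n)%N ->
  \sum_(i < n) ((i == k :> nat)%:R : R) = 1.
Proof.
move=> kn; rewrite (bigD1 (Ordinal kn))//= eqxx big1 ?addr0// => i.
by rewrite -val_eqE/= => /negbTE ->.
Qed.

(** The gap scales with [a] times the number of links, the Lipschitz constant of the gradient with
    [a * b ^+ 2]. *)
Lemma function_class_scaled_chain (R : realType) (d : nat) (L delta0 a b : R) :
  0 <= a -> 0 <= b -> 27 * (a * b ^+ 2) <= L -> a * d.+1%:R <= delta0 ->
  function_class delta0 L (@scaled_chain R d a b (fun=> 1) 1).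
Proof.
move=> a0 b0 abL ad.
have c1 (j : nat) : `|(fun=> 1 : R) j| <= 1 by rewrite normr1.
have h1 : `|1 : R| <= 1 by rewrite normr1.
split.
- by move=> x; have [] := grad_scaled_chain a b x c1 h1.
- move=> x y; have [_ ->] := grad_scaled_chain a b x c1 h1.
  have [_ ->] := grad_scaled_chain a b y c1 h1.
  rewrite -scalerBr enormZ ger0_norm ?mulr_ge0//.
  apply: (@le_trans _ _ (a * b * (27 * enorm (b *: (x - y))))).
    by rewrite ler_wpM2l ?mulr_ge0// scalerBr chain_grad_lip.
  rewrite enormZ ger0_norm//.
  have -> : a * b * (27 * (b * enorm (x - y))) = 27 * (a * b ^+ 2) * enorm (x - y).
    by ring.
  by rewrite ler_wpM2r ?enorm_ge0.
- set f := scaled_chain _ _ _ _.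
  have f_ge x : f 0 - delta0 <= f x.
    clear c1 h1.
    have := @chain_ge R d (fun=> 1) (b *: x); rewrite ler01 lexx => /(_ (fun=> isT)) fx.
    have := @chain0_le R d (fun=> 1) (fun=> ler01).
    move=> /(ler_wpM2l a0); rewrite mulr0 => f0.
    have := ler_wpM2l a0 fx; rewrite mulrN /f /scaled_chain scaler0; lra.
  apply: (@le_trans _ _ ((f 0)%:E - (f 0 - delta0)%:E)%E).
    by rewrite leeB//; apply: le_ereal_inf_tmp => _ [x _ <-]; rewrite lee_fin.
  by rewrite -EFinB lee_fin opprB addrC subrK.
Qed.

Lemma grad_scaled_chain_stuck (R : realType) (d : nat) (a b : R) (x : 'rV[R]_d) :
  (0 < d)%N -> supp x `<=` [set j | (j < d.-1)%N] ->
  16^-1 * (a * b) ^+ 2 <= enorm (grad (scaled_chain a b (fun=> 1) 1) x) ^+ 2.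
Proof.
move=> d0 xd; have c1 (j : nat) : `|(fun=> 1 : R) j| <= 1 by rewrite normr1.
have h1 : `|1 : R| <= 1 by rewrite normr1.
have [_ ->] := grad_scaled_chain a b x c1 h1.
rewrite enormZ [leRHS]exprMn real_normK ?num_real// mulrC ler_wpM2l ?sqr_ge0//.
apply: chain_stuck => //; rewrite extZ.
have [i id] : exists i : 'I_d, i = d.-1 :> nat.
  by exists (Ordinal (eq_leq (prednK d0))).
suff -> : ext x d.-1 = 0 by rewrite mulr0.
rewrite -id ext_ord; apply/eqP/negPn/negP => /xd/=.
by rewrite id ltnn.
Qed.

(** * Events generated by the multipliers of one round *)

Section SigmaGenerated.
Context (dd : measure_display) (T : measurableType dd) (R : realType).
Variables (P : probability T R) (I : Type) (X : I -> {RV P >-> R}).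

Lemma sigma_generated_measurable (E : set T) :
  sigma_generated (fun i => X i : T -> R) E -> measurable E.
Proof.
apply: smallest_sub; first exact: sigma_algebra_measurable.
by move=> _ [i _ [B mB <-]]; exact: measurable_funPTI.
Qed.

Lemma sigma_generated_neq0 (i : I) :
  sigma_generated (fun i => X i : T -> R) [set w | X i w != 0].
Proof.
apply: sub_sigma_algebra; exists i => //; exists (~` [set 0]).
  by apply: measurableC; exact: measurable_set1.
by apply/seteqP; split=> w /= /eqP.
Qed.

End SigmaGenerated.

Theorem theoremG4 (R : realType) :
  exists cbar chat : R, [/\ 0 < cbar, 0 < chat &
    forall (p L delta0 eps : R) (n : nat),
      0 < p -> 0 < L -> 0 < delta0 -> 0 < eps -> (2 <= n)%N ->
      cbar * eps < L * delta0 ->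
    forall (dd : measure_display) (T : measurableType dd)
      (P : probability T R) (eta : nat -> 'I_n -> nat -> {RV P >-> R}),
      (forall k i j, (P [set w | (eta k i j w != 0)%R] <= p%:E)%E) ->
      mutually_independent P
        (fun k => sigma_generated
           (fun (ij : 'I_n * nat) (w : T) => eta k ij.1 ij.2 w)) ->
    forall A : algorithm R n, zero_respecting A ->
    exists (d : nat) (f : 'rV[R]_d -> R) (fs : 'I_n -> 'rV[R]_d -> R),
      [/\ function_class delta0 L f,
          forall i x, differentiable (fs i) x,
          forall x, f x = n%:R^-1 * \sum_(i < n) fs i x &
          forall k : nat, k%:R <= chat * (L * delta0 / (p * eps)) ->
            (eps%:E < 'E_P[fun w : T => (
                 enorm (grad f (server_point A (fun i => grad (fs i))
                   (fun k' i j => eta k' i j w) k)) ^+ 2)%R])%E]].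
Proof.
(* [K] is kept opaque: closing steps would otherwise unfold the numeral. *)
have [K KE] : exists K : R, K = 27 * 64 by exists (27 * 64).
have K0 : 0 < K by rewrite KE mulr_gt0.
(* With [K] = 27 * 64, the choices of [a] and [b] below give (ab)^2 = 64 eps, so a stuck point has
   squared gradient norm at least 4 eps. The factors 16 and 8 give Y > 16 and k p <= Y / 8. *)
exists (K * 16), (K * 8)^-1; split; rewrite ?invr_gt0 ?mulr_gt0//.
move=> p L delta0 eps n p0 L0 delta0_gt0 eps0 n2 cbarP dd T P eta etaP eta_indep A A_zr.
pose Y := L * delta0 / (K * eps).
have Y16 : 16 < Y by rewrite ltr_pdivlMr ?mulr_gt0//; lra.
have /andP[tY Yt] : (Num.truncn Y)%:R <= Y < (Num.truncn Y).+1%:R.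
  by apply: truncn_itv; lra.
(* [Y] is [delta0 / a] for the [a] below, the number of links that the gap allows; a chain of
   dimension [d] has d + 1 links, counting the dummy one. *)
pose d := (Num.truncn Y).-1.
have t16 : (16 <= Num.truncn Y)%N by rewrite truncn_ge_nat; lra.
have dS : d.+1 = Num.truncn Y by rewrite prednK//; lia.
have d0 : (0 < d)%N by rewrite /d; lia.
rewrite -dS in tY Yt.
pose a := K * eps / L; pose b := Num.sqrt (L / (27 * a)).
have a0 : 0 < a by rewrite divr_gt0// mulr_gt0.
have b0 : 0 <= b by exact: sqrtr_ge0.
have abL : a * b ^+ 2 = L / 27.
  rewrite sqr_sqrtr; last by rewrite ltW// divr_gt0// mulr_gt0.
  by field; rewrite gt_eqF.
have ab2 : (a * b) ^+ 2 = 64 * eps.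
  rewrite exprMn expr2 -mulrA abL /a KE.
  by field; rewrite gt_eqF.
have odd_lt r : (odd r < n)%N by apply: leq_trans n2; case: odd.
pose owner r : 'I_n := Ordinal (odd_lt r).
have n0 : (n%:R : R) != 0 by rewrite pnatr_eq0; lia.
pose c (i : 'I_n) (j : nat) : R := (i == odd j :> nat)%:R.
(* All ramps go to worker 0: having zero slope at 0, they reveal no coordinate. *)
pose h (i : 'I_n) : R := (i == 0%N :> nat)%:R.
have c1 i j : `|c i j| <= 1 by rewrite /c; case: (_ == _); rewrite ?normr0 ?normr1.
have h1 i : `|h i| <= 1 by rewrite /h; case: (_ == _); rewrite ?normr0 ?normr1.
pose f : 'rV[R]_d -> R := scaled_chain a b (fun=> 1) 1.
pose fs (i : 'I_n) : 'rV[R]_d -> R := scaled_chain (n%:R * a) b (c i) (h i).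
have fs_diff i x : differentiable (fs i) x.
  by have [] := grad_scaled_chain (n%:R * a) b x (c1 i) (h1 i).
exists d, f, fs; split=> //.
- apply: function_class_scaled_chain => //; first exact: ltW.
    by rewrite abL mulrCA divff ?mulr1.
  have -> : delta0 = a * Y by rewrite /a /Y; field; rewrite !gt_eqF.
  by rewrite ler_wpM2l// ltW.
- move=> x; rewrite sum_scaled_chain /h sum_indicator ?(leq_trans _ n2)//.
  rewrite (_ : (fun j => _) = fun=> 1); last first.
    by apply/funext => j; exact: sum_indicator.
  by rewrite /f /scaled_chain !mulrA mulVf// mul1r.
move=> k kY.
have fs_supp i r (x : 'rV[R]_d) : i != owner r ->
    supp x `<=` [set j | (j < r)%N] -> supp (grad (fs i) x) `<=` [set j | (j < r)%N].
  move=> ir xr; have [_ ->] := grad_scaled_chain (n%:R * a) b x (c1 i) (h1 i).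
  have suppZ (s : R) (y : 'rV[R]_d) : supp (s *: y) `<=` supp y.
    by move=> j; rewrite /supp/= mxE mulf_eq0 negb_or => /andP[].
  apply: (subset_trans (suppZ _ _)); apply: chain_grad_supp.
    by move: ir; rewrite /c -val_eqE/= => /negbTE ->.
  exact: subset_trans (suppZ _ _) xr.
have owner_neq r : owner r.+1 != owner r by rewrite -val_eqE/=; case: odd.
pose B k r : set T := [set w | eta k (owner r) r.-1 w != 0].
have B_level l r : sigma_generated
    (fun (ij : 'I_n * nat) (w : T) => eta l ij.1 ij.2 w) (B l r).
  exact: (@sigma_generated_neq0 _ _ _ _ _ (fun ij => eta l ij.1 ij.2) (owner r, r.-1)).
have S_meas l E : sigma_generated
    (fun (ij : 'I_n * nat) (w : T) => eta l ij.1 ij.2 w) E -> measurable E.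
  exact: (sigma_generated_measurable (X := fun ij => eta l ij.1 ij.2)).
have S_setC l E : sigma_generated
    (fun (ij : 'I_n * nat) (w : T) => eta l ij.1 ij.2 w) E -> sigma_generated
    (fun (ij : 'I_n * nat) (w : T) => eta l ij.1 ij.2 w) (~` E).
  exact: sigma_algebraC.
have B_prob l r : (P (B l r) <= p%:E)%E by exact: etaP.
(* Off this event the count is at most d - 1, so the last coordinate of the server point is still
   0. *)
pose N := [set w | (d.-1 < random_progress B k w)%N].
have mN : measurable N by exact: (measurable_progress_gt S_meas S_setC eta_indep B_level).
have PN : (d%:R%:E * P N <= (1 + k%:R * p)%:E)%E.
  by rewrite -(prednK d0); exact: (progress_markov S_meas S_setC eta_indep B_level B_prob).
have PN2 : (P N <= 2^-1%:E)%E.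
  have PNfin : P N \is a fin_num by rewrite fin_num_measure.
  rewrite -(fineK PNfin) lee_fin; rewrite -(fineK PNfin) -EFinM lee_fin in PN.
  have dR : 0 < d%:R :> R by rewrite ltr0n.
  rewrite -(ler_pM2l dR); apply: (le_trans PN).
  (* Since Y < d + 2 and Y > 16, this bound gives 1 + k p <= d / 2. *)
  have kp : k%:R * p <= Y / 8.
    rewrite -ler_pdivlMr//; apply: (le_trans kY).
    rewrite le_eqVlt; apply/orP; left; apply/eqP.
    by rewrite /Y; field; rewrite !gt_eqF.
  have dSS : d.+2%:R = d%:R + 2 :> R by rewrite -addn2 natrD.
  move: Yt; rewrite dSS; move: (d%:R : R) (k%:R * p) kp Y16 => x y; lra.
(* The complement of [N] has probability at least 1/2, so this product is at least 2 eps. *)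
apply: (@lt_le_trans _ _ ((4 * eps)%:E * P (~` N))%E).
  have PNfin : P N \is a fin_num by rewrite fin_num_measure.
  rewrite probability_setC//; rewrite -(fineK PNfin); rewrite -(fineK PNfin) in PN2.
  rewrite -EFinB -EFinM lte_fin; rewrite lee_fin in PN2; nra.
apply: expectation_ge_indic.
- exact: measurableC.
- by rewrite mulr_ge0// ltW.
- by move=> w; exact: sqr_ge0.
move=> w /negP; rewrite -leqNgt => qd.
have -> : 4 * eps = 16^-1 * (a * b) ^+ 2 by rewrite ab2; field.
apply: grad_scaled_chain_stuck => //.
apply: (subset_trans (server_point_supp (owner := owner) A_zr fs_diff owner_neq fs_supp (k := k))).
move=> j /= jq; apply: leq_trans jq _; apply: leq_trans qd.
rewrite /random_progress; set act := fun _ _ => _; set act' := fun _ _ => _.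
suff -> : act = act' by [].
by apply/funext => l; apply/funext => r; apply/idP/idP; rewrite inE.
Qed.
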